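(* Any locally-finite bucolic graph $G$ has $G^2$-connected medians; that is, for every profile $\pi$ on $G$, the median set $\mathrm{Med}(\pi)$ induces a connected subgraph of $G^2$.
   Context: Graphs are undirected, connected, without loops or multiple edges, and not necessarily finite. A graph is locally-finite if all its vertices have finite degree. $d$ is the standard graph distance of $G=(V,E)$. $G^2$ has vertex set $V$, and distinct $u,v$ are adjacent iff $d(u,v)\le 2$. A profile is a map $\pi:V\to[0,\infty)$ with finite support, $F_\pi(x)=\sum_{u}\pi(u)d(u,x)$, and $\mathrm{Med}(\pi)$ is the set of vertices minimizing $F_\pi$. $G$ is weakly modular if for every vertex $u$ the following two conditions hold. Triangle condition: for any $v,w$ with $1=d(v,w)<d(u,v)=d(u,w)$ there is a common neighbor $x$ of $v,w$ with $d(u,x)=d(u,v)-1$. Quadrangle condition: for any $v,w,z$ with $d(v,z)=d(w,z)=1$ and $2=d(v,w)\le d(u,v)=d(u,w)=d(u,z)-1$ there is a common neighbor $x$ of $v,w$ with $d(u,x)=d(u,v)-1$. A weakly bridged graph is a weakly modular graph in which every ball $B_r(v)=\{x:d(v,x)\le r\}$ is convex (contains all shortest paths between any two of its vertices). Bucolic graphs are the retracts of (weak) Cartesian products of weakly bridged graphs. Equivalently (a known characterization that can be used as the definition), they are the weakly modular graphs not containing $K_{2,3}$, $W_4$, $W_4^-$ as induced subgraphs, where $W_4$ is the 4-cycle plus a central vertex adjacent to all its vertices, and $W_4^-$ is $W_4$ minus an edge joining the central vertex to a vertex of the 4-cycle. *)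

(* Defs.v *)
From HB Require Import structures.
From mathcomp Require Import all_boot all_order all_algebra.
From mathcomp Require Import boolp classical_sets cardinality fsbigop reals.

Set Implicit Arguments.
Unset Strict Implicit.
Unset Printing Implicit Defensive.

Import Order.TTheory GRing.Theory Num.Theory.
Local Open Scope classical_set_scope.

(* Connectedness is kept as a separate predicate, so that Cartesian products
   and induced subgraphs can be formed without side conditions. *)
Record sgraph := SGraph {
  vertex :> choiceType;
  adj : rel vertex;
  adj_sym : symmetric adj;
  adj_irr : irreflexive adj }.

Arguments adj {_}.

Definition connected (G : sgraph) : Prop :=
  forall u v : G, exists p : seq G, path adj u p /\ last u p = v.

Definition locally_finite (G : sgraph) : Prop :=
  forall v : G, finite_set [set u : G | adj v u].

Definition walk_of_length (G : sgraph) (u v : G) (n : nat) : Prop :=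
  exists p : seq G, [/\ path adj u p, last u p = v & size p = n].

Lemma asbool_ex (P : nat -> Prop) :
  (exists n, P n) -> exists n, (fun m => `[< P m >]) n.
Proof. by case=> n Pn; exists n; apply/asboolP. Qed.

(* Least length of a walk from u to v; the value 0 taken when there is none is
   never relevant, since all graphs considered are connected. *)
Definition dist (G : sgraph) (u v : G) : nat :=
  match pselect (exists n, walk_of_length u v n) with
  | left e => ex_minn (asbool_ex e)
  | right _ => 0
  end.

Section Induced.
Variables (G : sgraph) (A : set G).

Definition induced_adj : rel {x : G | x \in A} :=
  fun u v => adj (sval u) (sval v).

Lemma induced_sym : symmetric induced_adj.
Proof. by move=> u v; rewrite /induced_adj adj_sym. Qed.

Lemma induced_irr : irreflexive induced_adj.
Proof. by move=> u; rewrite /induced_adj adj_irr. Qed.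

Definition induced : sgraph := SGraph induced_sym induced_irr.
End Induced.

Section Square.
Variable G : sgraph.

Lemma dist_sym (u v : G) : dist u v = dist v u.
Proof.
have W (x y : G) n : walk_of_length x y n -> walk_of_length y x n.
  case=> p [xp <- <-]; exists (rev (belast x p)); split.
  - by rewrite rev_path; under eq_path do rewrite adj_sym.
  - by case: p {xp} => //= z p; rewrite rev_cons last_rcons.
  - by rewrite size_rev size_belast.
rewrite /dist; case: pselect => [e|ne]; case: pselect => [f|nf] //.
- apply: eq_ex_minn => n.
  by apply: asbool_equiv_eq; split; apply: W.
- by case: nf; case: e => n /W; exists n.
- by case: ne; case: f => n /W; exists n.
Qed.

Definition square_adj : rel G := fun u v => (u != v) && (dist u v <= 2)%N.

Lemma square_sym : symmetric square_adj.
Proof. by move=> u v; rewrite /square_adj eq_sym dist_sym. Qed.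

Lemma square_irr : irreflexive square_adj.
Proof. by move=> u; rewrite /square_adj eqxx. Qed.

Definition square : sgraph := SGraph square_sym square_irr.
End Square.

Definition graph_iso (G H : sgraph) : Prop :=
  exists2 f : G -> H, bijective f & forall u v : G, adj (f u) (f v) = adj u v.

Definition triangle_condition (G : sgraph) (u : G) : Prop :=
  forall v w : G,
    dist v w = 1%N -> (1 < dist u v)%N -> dist u v = dist u w ->
    exists x : G, [/\ adj x v, adj x w & dist u x = (dist u v - 1)%N].

Definition quadrangle_condition (G : sgraph) (u : G) : Prop :=
  forall v w z : G,
    dist v z = 1%N -> dist w z = 1%N ->
    dist v w = 2%N -> (2 <= dist u v)%N ->
    dist u v = dist u w -> dist u w = (dist u z - 1)%N ->
    exists x : G, [/\ adj x v, adj x w & dist u x = (dist u v - 1)%N].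

Definition weakly_modular (G : sgraph) : Prop :=
  forall u : G, triangle_condition u /\ quadrangle_condition u.

Definition gball (G : sgraph) (v : G) (r : nat) : set G :=
  [set x | (dist v x <= r)%N].

Definition gconvex (G : sgraph) (A : set G) : Prop :=
  forall u v : G, A u -> A v ->
  forall p : seq G, path adj u p -> last u p = v -> size p = dist u v ->
  forall x : G, x \in p -> A x.

Definition weakly_bridged (G : sgraph) : Prop :=
  [/\ connected G, weakly_modular G &
      forall (v : G) (r : nat), gconvex (gball v r)].

Section CartesianProduct.
Variables (I : Type) (H : I -> sgraph).

Definition cart_adj : rel (forall i, H i) := fun f g =>
  `[< exists i, adj (f i) (g i) /\ forall j, j <> i -> f j = g j >].

Lemma cart_sym : symmetric cart_adj.
Proof.
move=> f g; apply: asbool_equiv_eq.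
by split=> -[i [a e]]; exists i; split=> [|j /e //]; rewrite adj_sym.
Qed.

Lemma cart_irr : irreflexive cart_adj.
Proof. by move=> f; apply/asboolP=> -[i []]; rewrite adj_irr. Qed.

Definition cart_product : sgraph := SGraph cart_sym cart_irr.

(* For connected factors this is the connected component of b in the Cartesian
   product; it is the whole product when I is finite. *)
Definition weak_cart_product (b : forall i, H i) : sgraph :=
  @induced cart_product [set f | finite_set [set i | f i <> b i]].
End CartesianProduct.

Definition retraction (H : sgraph) (phi : H -> H) : Prop :=
  (forall x, phi (phi x) = phi x) /\
  (forall x y, (dist (phi x) (phi y) <= dist x y)%N).

Definition retract_of (G H : sgraph) : Prop :=
  exists2 phi : H -> H, retraction phi & graph_iso G (induced (range phi)).

Definition bucolic (G : sgraph) : Prop :=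
  exists (I : Type) (H : I -> sgraph) (b : forall i, H i),
    (forall i, weakly_bridged (H i)) /\ retract_of G (weak_cart_product b).

Definition profile (R : realType) (G : sgraph) (pi : G -> R) : Prop :=
  (forall u, 0 <= pi u)%R /\ finite_set [set u | pi u != 0%R].

(* The sum over all vertices is finitely supported for a profile pi. *)
Definition median_fun (R : realType) (G : sgraph) (pi : G -> R) (x : G) : R :=
  (\sum_(u \in [set: G]) pi u * (dist u x)%:R)%R.

Definition Med (R : realType) (G : sgraph) (pi : G -> R) : set G :=
  [set x | forall y : G, (median_fun pi x <= median_fun pi y)%R].

(* Main.v *)
Require Import Defs.
From mathcomp Require Import all_boot all_order all_algebra.
From mathcomp Require Import boolp classical_sets cardinality fsbigop reals.
From mathcomp Require Import zify lra.

Set Implicit Arguments.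
Unset Strict Implicit.
Unset Printing Implicit Defensive.

Import Order.TTheory GRing.Theory Num.Theory.
Local Open Scope nat_scope.
Local Open Scope classical_set_scope.

(** Why the theorem holds.  If u and v are medians at distance at least 3, it
suffices to find u' and v' such that u' is strictly closer to both u and v than
they are to each other, and d(x,u') + d(x,v') <= d(x,u) + d(x,v) for every x in
the support of the profile: summing with weights shows that u' and v' are
medians too, and induction on d(u,v) joins u to u' and u' to v by steps of
length at most 2.  This existence statement, for an arbitrary finite set of
vertices x, is [lozenge_property]; the point is that it holds in weakly bridged
graphs and passes to weak Cartesian products and retracts, hence holds in
bucolic graphs.

Weakly bridged graphs ([weakly_bridged_lozenge]).  Let k = d(u,v).  By convexity
of balls and the triangle condition, each x has a neighbour u_x of u, one step
closer to v, that is strictly closer to x than u is whenever v is, and that is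
not farther from x than u is unless u lies between x and v
([approach_exists]).  The vertices u_x form a clique at distance k-1 from v, and
a finite clique in a sphere has a common neighbour u' in the next smaller sphere
([clique_apex]); so u' is at distance 2 from u.  With v' obtained in the same way
from v, the inequality follows: if x is closer to u than to v, passing from v to
v' gains 1 and passing from u to u' loses at most 1 (or gains 2 and loses at most
2, if u is between x and v); if x is equidistant, convexity of the ball around x
applies.  Choosing the clique from finitely many x is what makes the argument
work when cliques may be infinite.

Products ([product_lozenge]).  The distance is the distance in one coordinate
plus the distance with that coordinate frozen ([dist_split]).  If u and v differ
in at least two coordinates, exchanging the values of one of them gives u' and
v' with equality of the two sums; otherwise the question lies in one factor.

Retracts ([retract_lozenge]).  The retraction is non-expansive and fixes u, v
and every x, so it can only decrease the distances to u' and v'. *)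

(** * Distances in connected graphs *)

Lemma dist_le_size (G : sgraph) (u : G) p :
  path adj u p -> dist u (last u p) <= size p.
Proof.
move=> up; rewrite /dist; case: pselect => // e.
by case: ex_minnP => m _; apply; apply/asboolP; exists p.
Qed.

Lemma distxx (G : sgraph) (u : G) : dist u u = 0.
Proof. by apply/eqP; rewrite -leqn0; apply: (@dist_le_size _ u [::]). Qed.

Section ConnectedGraph.
Variables (G : sgraph) (Gconn : connected G).
Implicit Types a b c d u v w x y : G.

Lemma geodesic_exists u v :
  exists p, [/\ path adj u p, last u p = v & size p = dist u v].
Proof.
have e : exists n, walk_of_length u v n.
  by have [p [up pv]] := Gconn u v; exists (size p), p.
rewrite /dist; case: pselect => // e'.
by case: ex_minnP => m /asboolP.
Qed.

Lemma dist_triangle v u w : dist u w <= dist u v + dist v w.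
Proof.
have [p [up pv <-]] := geodesic_exists u v.
have [q [vq <- <-]] := geodesic_exists v w.
by rewrite -size_cat -pv -last_cat dist_le_size // cat_path up pv.
Qed.

Lemma dist_eq0 u v : dist u v = 0 -> u = v.
Proof.
by have [p [_ <- <-]] := geodesic_exists u v => /size0nil ->.
Qed.

Lemma dist_gt0 u v : u <> v -> 0 < dist u v.
Proof. by case: posnP => // /dist_eq0. Qed.

Lemma dist_adj u v : adj u v -> dist u v = 1.
Proof.
move=> uv; apply/eqP; rewrite eqn_leq.
rewrite (@dist_le_size _ u [:: v]) /= ?uv // dist_gt0 // => e.
by rewrite e adj_irr in uv.
Qed.

Lemma dist_le1 u v : dist u v <= 1 -> u = v \/ adj u v.
Proof.
have [[|w [|w' p]] [/= + <- <-]] := geodesic_exists u v => //.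
  by left.
by rewrite andbT; right.
Qed.

Lemma dist_adjl w u v : adj u w -> dist u v <= (dist w v).+1.
Proof. by move/dist_adj=> uw; rewrite -add1n -uw dist_triangle. Qed.

Lemma step_towards u v : u <> v ->
  exists2 w, adj u w & dist u v = (dist w v).+1.
Proof.
have [[|w p] [/= up pv pn]] := geodesic_exists u v => // _.
case/andP: up => uw wp; exists w => //; apply/eqP.
by rewrite eqn_leq dist_adjl // -pn ltnS -pv dist_le_size.
Qed.

Lemma ball_convex x r u v w :
    gconvex (gball x r) -> dist x u <= r -> dist x v <= r ->
    dist u w + dist w v = dist u v -> dist x w <= r.
Proof.
move=> cvx xu xv uwv.
have [p [up pw ps]] := geodesic_exists u w.
have [q [wq qv qs]] := geodesic_exists w v.
case: (p =P [::]) => [p0|pn0]; first by rewrite -pw p0.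
apply: (cvx u v xu xv (p ++ q)).
- by rewrite cat_path up pw.
- by rewrite last_cat pw.
- by rewrite size_cat ps qs.
- case: p pn0 pw {up ps} => //= a p _ <-.
  by rewrite in_cons mem_cat; have := mem_last a p; rewrite in_cons orbA => ->.
Qed.

End ConnectedGraph.

(** * Lozenges *)

(** Only the vertices x of a finite list are considered: this is enough for a
finitely supported profile, while treating all x at once would require common
neighbours of infinite cliques, as the factors of a locally finite bucolic graph
may have infinite degree. *)
Definition lozenge_property (G : sgraph) : Prop :=
  forall (u v : G) (s : seq G), 2 < dist u v ->
  exists u' v', [/\ dist u u' < dist u v, dist u' v < dist u v &
    forall x, x \in s -> dist x u' + dist x v' <= dist x u + dist x v].

(** * Weakly bridged graphs *)

Section WeaklyBridged.
Variables (G : sgraph) (Gwb : weakly_bridged G).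
Implicit Types a b c d u v w x y : G.

Let Gconn : connected G. Proof. by case: Gwb. Qed.

Lemma ball_between x r u v w : dist x u <= r -> dist x v <= r ->
  dist u w + dist w v = dist u v -> dist x w <= r.
Proof. by apply: ball_convex => //; case: Gwb. Qed.

Lemma triangle_apex x u v : adj u v -> dist x u = dist x v -> 1 < dist x u ->
  exists y, [/\ adj u y, adj v y & dist x u = (dist x y).+1].
Proof.
move=> uv xuv xu; have [_ /(_ x)[tri _] _] := Gwb.
have [y [yu yv xy]] := tri u v (dist_adj Gconn uv) xu xuv.
by exists y; split; [rewrite adj_sym|rewrite adj_sym|lia].
Qed.

(** Otherwise w would lie on a shortest path between two vertices of the ball
around x of radius d(x,w) - 1. *)
Lemma closer_neighbors x w a b :
  adj w a -> adj w b -> dist x a < dist x w -> dist x b < dist x w ->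
  a = b \/ adj a b.
Proof.
move=> wa wb xa xb; apply: (dist_le1 Gconn); rewrite leqNgt; apply/negP => ab.
have xw : dist x w <= (dist x w).-1.
  apply: (@ball_between _ _ a b); [lia|lia|].
  have := dist_triangle Gconn w a b.
  by rewrite (dist_sym a w) !(dist_adj Gconn wa) !(dist_adj Gconn wb); lia.
lia.
Qed.

Lemma no_induced_square a b c d :
  adj a b -> adj b c -> adj c d -> adj d a -> a <> c -> b <> d ->
  adj a c \/ adj b d.
Proof.
move=> ab bc cd da ac bd; case: (boolP (adj a c)) => [|nac]; first by left.
right.
have ac2 : 1 < dist a c.
  by rewrite ltnNge; apply/negP => /(dist_le1 Gconn)[//|]; apply/negP.
have : dist b d <= 1.
  apply: (@ball_between _ _ a c).
  - by rewrite dist_sym (dist_adj Gconn ab).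
  - by rewrite (dist_adj Gconn bc).
  - have := dist_triangle Gconn d a c.
    rewrite (dist_sym a d) (dist_sym d c).
    by rewrite !(dist_adj Gconn da) !(dist_adj Gconn cd); lia.
by case/(dist_le1 Gconn).
Qed.

(** Take any neighbour w of u towards v.  If it is not closer to x, apply
induction to w: the resulting w1 and the apex of the triangle on the edge u w
are both closer to x than w, hence adjacent or equal, so that the apex is also
one step closer to v. *)
Lemma step_towards_closer x u v : u <> v -> dist x v < dist x u ->
  exists w, [/\ adj u w, dist u v = (dist w v).+1 & dist x w < dist x u].
Proof.
elim: {u}(dist u v) {-2}u (erefl (dist u v)) => [|k IH] u uvk uv xvu.
  by case: uv; apply: dist_eq0.
have [w uw uwv] := step_towards Gconn uv.
have xw : dist x w <= dist x u.
  apply: (@ball_between _ _ u v) => //; first exact: ltnW.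
  by rewrite (dist_adj Gconn uw) uwv.
case: (ltnP (dist x w) (dist x u)) => [|xw']; first by exists w.
have {xw xw'} xwu : dist x u = dist x w by lia.
have wv : w <> v by move=> e; move: xvu; rewrite xwu e ltnn.
have [//|//||w1 [ww1 w1v xw1]] := IH w; [lia|lia|].
have [|y [uy wy xy]] := @triangle_apex x u w uw xwu.
  case: (posnP (dist x v)) => [/(dist_eq0 Gconn) xv|]; last lia.
  have := dist_gt0 Gconn wv; rewrite xv dist_sym in uwv *; lia.
exists y; split=> //; last lia.
(* y and w1 at distance at most 1 forces y, a neighbour of u, to be one step
   closer to v than u. *)
have yw1 : dist y w1 <= 1.
  have [|->|/(dist_adj Gconn) -> //] := closer_neighbors wy ww1 _ xw1; first lia.
  by rewrite distxx.
have := dist_triangle Gconn w1 y v; have := dist_adjl Gconn v uy; lia.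
Qed.

(** The hypothesis excludes only the case where u lies between x and v, in which
every step towards v leads away from x.  If a neighbour w of u towards v is
farther from x, the next vertex w1 given by induction is as far as w by
convexity of balls, and the apex of the triangle on the edge w w1 is the wanted
vertex: it is adjacent to u since u and it are both closer to x than w. *)
Lemma step_towards_not_farther x u v :
  u <> v -> dist x v < dist x u + dist u v ->
  exists w, [/\ adj u w, dist u v = (dist w v).+1 & dist x w <= dist x u].
Proof.
elim: {u}(dist u v) {-2}u (erefl (dist u v)) => [|k IH] u uvk uv xvu.
  by case: uv; apply: dist_eq0.
have [w uw uwv] := step_towards Gconn uv.
case: (leqP (dist x w) (dist x u)) => [|xuw]; first by exists w.
have xw : dist x w = (dist x u).+1.
  have := dist_triangle Gconn u x w; rewrite (dist_adj Gconn uw); lia.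
have wv : w <> v.
  by move=> e; move: xvu; rewrite uwv -e distxx xw; lia.
have [|||w1 [ww1 w1v xw1]] := IH w; [lia|done|lia|].
(* w is on a shortest path from u to w1. *)
have uw1 : dist u w1 = 2.
  have := dist_triangle Gconn w1 u v; have := dist_triangle Gconn w u w1.
  by rewrite (dist_adj Gconn uw) (dist_adj Gconn ww1); lia.
have xw1w : dist x w1 = dist x w.
  apply/eqP; rewrite eqn_leq xw1 leqNgt; apply/negP => lt.
  suff : dist x w <= dist x u by lia.
  apply: (@ball_between _ _ u w1) => //; first lia.
  by rewrite (dist_adj Gconn uw) (dist_adj Gconn ww1) uw1.
have [|y [wy w1y xy]] := @triangle_apex x w w1 ww1 (esym xw1w).
  case: (posnP (dist x u)) => [/(dist_eq0 Gconn) xu|]; last lia.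
  by move: xvu; rewrite xu distxx; lia.
have wu : adj w u by rewrite adj_sym.
have [||yu|uy] := closer_neighbors wu wy (x := x); [lia|lia| |].
  by move: uw1; rewrite yu dist_sym (dist_adj Gconn w1y).
exists y; split=> //; last lia.
rewrite adj_sym in w1y.
have := dist_adjl Gconn v w1y; have := dist_adjl Gconn v uy; lia.
Qed.

Definition approach x u v w : Prop :=
  [/\ adj u w, dist u v = (dist w v).+1,
      dist x v < dist x u -> dist x w < dist x u &
      dist x v < dist x u + dist u v -> dist x w <= dist x u].

Lemma approach_exists x u v : u <> v -> exists w, approach x u v w.
Proof.
move=> uv; case: (ltnP (dist x v) (dist x u)) => [xvu|xuv].
  have [w [? ? ?]] := step_towards_closer uv xvu.
  by exists w; split=> // _; apply: ltnW.
case: (ltnP (dist x v) (dist x u + dist u v)) => [xvu|xuv'].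
  have [w [? ? ?]] := step_towards_not_farther uv xvu.
  by exists w; split=> //; lia.
by have [w uw uwv] := step_towards Gconn uv; exists w; split=> //; lia.
Qed.

(** Induction on the clique.  If the common neighbour y found so far is not
adjacent to the new vertex b, the apex z of the triangle on the edge a b is
adjacent to every other c, since c, b, z, y is a 4-cycle with y and b not
adjacent. *)
Lemma clique_apex x n a (s : seq G) :
  1 < n -> (forall b, b \in a :: s -> dist x b = n) ->
  (forall b c, b \in a :: s -> c \in a :: s -> b = c \/ adj b c) ->
  exists y, dist x y = n.-1 /\ forall b, b \in a :: s -> adj b y.
Proof.
move=> n1; elim: s => [|b s IH] xn clique.
  have xa : dist x a = n by apply: xn; rewrite mem_head.
  have [|y ay] := @step_towards _ Gconn a x.
    by move=> e; move: xa; rewrite e distxx; lia.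
  rewrite dist_sym xa dist_sym => ->; exists y; split=> // c.
  by rewrite inE => /eqP ->.
have sub c : c \in a :: s -> c \in [:: a, b & s].
  by rewrite !inE => /orP[->|->]; rewrite ?orbT.
have ab_in : (a \in [:: a, b & s]) * (b \in [:: a, b & s]).
  by rewrite !inE !eqxx orbT.
have [||y [xy sy]] := IH.
- by move=> c /sub; apply: xn.
- by move=> c d /sub cs /sub; apply: clique.
have ay : adj a y by apply: sy; rewrite mem_head.
have xa : dist x a = n by rewrite xn ?ab_in.
have xb : dist x b = n by rewrite xn ?ab_in.
have extend z : dist x z = n.-1 -> (forall c, c \in a :: s -> adj c z) ->
    adj b z -> exists y, dist x y = n.-1 /\
    forall c, c \in [:: a, b & s] -> adj c y.
  move=> xz sz bz; exists z; split=> // c; rewrite !inE => /or3P[/eqP->|/eqP->|cs] //.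
    by apply: sz; rewrite mem_head.
  by apply: sz; rewrite inE cs orbT.
case: (boolP (adj b y)) => [by_|nby]; first exact: (extend y).
have [ab|ab] := clique a b ab_in.1 ab_in.2; first by rewrite -ab ay in nby.
have [||z [az bz xz]] := @triangle_apex x a b ab.
- by rewrite xa xb.
- by rewrite xa.
apply: (extend z) => //; first lia.
have yz : adj y z.
  have [||yz|//] := closer_neighbors ay az (x := x); [lia|lia| ].
  by rewrite yz bz in nby.
move=> c cs; have cy := sy c cs.
have [cb|cb] := clique c b (sub c cs) ab_in.2; first by rewrite cb.
have cz : c <> z by move=> e; move: xz; rewrite -e (xn c) ?sub //; lia.
have by' : b <> y by move=> e; move: xy; rewrite -e; lia.
rewrite adj_sym in yz; rewrite adj_sym in cy.
by have [//|by_] := no_induced_square cb bz yz cy cz by'; rewrite by_ in nby.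
Qed.

(** What is left of [approach] for a vertex y two steps from u towards v: y may
be one unit farther from x than a single step, except that it stays closer to x
than u whenever v is, by convexity of balls. *)
Definition good_apex x u v y :=
  [/\ dist x v < dist x u -> dist x y < dist x u,
      dist x v < dist x u + dist u v -> dist x y <= (dist x u).+1 &
      dist x y <= (dist x u).+2].

Lemma apex_exists u v (s : seq G) : 2 < dist u v ->
  exists y, [/\ dist u y = 2, dist u v = dist y v + 2 &
    forall x, x \in s -> good_apex x u v y].
Proof.
move=> uv2.
have uv : u <> v by move=> e; rewrite e distxx in uv2.
have [f fP] := choice (fun x => approach_exists x uv).
have [|||y [vy ys]] := @clique_apex v (dist u v).-1 (f u) (map f s).
- by lia.
- by move=> b; rewrite -map_cons => /mapP[x _ ->]; rewrite dist_sym; have [] := fP x; lia.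
- move=> b c; rewrite -map_cons => /mapP[x _ ->] /mapP[z _ ->].
  have [ux uxv _ _] := fP x; have [uz uzv _ _] := fP z.
  by apply: (@closer_neighbors v u); rewrite // !(dist_sym v); lia.
rewrite dist_sym in vy.
have uy : dist u y <= 2.
  have [ufu _ _ _] := fP u.
  apply: leq_trans (dist_adjl Gconn y ufu) _.
  by rewrite (dist_adj Gconn) // ys ?mem_head.
have yv := dist_triangle Gconn y u v.
exists y; split; [lia|lia|] => x xs.
have [ux uxv xlt xle] := fP x.
have xy : dist x y <= (dist x (f x)).+1.
  have fxy : adj (f x) y by apply: ys; rewrite inE map_f ?orbT.
  have := dist_triangle Gconn (f x) x y; rewrite (dist_adj Gconn fxy); lia.
have fxy : dist (f x) y = 1.
  by apply: (dist_adj Gconn); apply: ys; rewrite inE map_f ?orbT.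
split.
- move=> xvu; have {}xlt := xlt xvu.
  (* y lies between f x and v, which are both in the ball around x of radius
     d(x,u) - 1. *)
  suff : dist x y <= (dist x u).-1 by lia.
  apply: (@ball_between _ _ (f x) v); lia.
- by move=> /xle; lia.
- have := dist_triangle Gconn u x y; lia.
Qed.

Lemma weakly_bridged_lozenge : lozenge_property G.
Proof.
move=> u v s uv2.
have [u' [uu' u'v us]] := apex_exists s uv2.
have [|v' [vv' v'u vs]] := @apex_exists v u s; first by rewrite dist_sym.
exists u', v'; split; [lia|lia|] => x xs.
have [u1 u2 u3] := us x xs; have [v1 v2 v3] := vs x xs.
rewrite dist_sym in v'u; rewrite (dist_sym v u) in v2.
have b1 := dist_triangle Gconn v x v'; have b2 := dist_triangle Gconn u x u'.
have b3 : dist x v' <= dist x u + dist u v'.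
  exact: dist_triangle.
have b4 : dist x u' <= dist x v + dist v u' by exact: dist_triangle.
rewrite (dist_sym v u') in b4; rewrite (dist_sym v' u) in v'u.
have b5 : dist x u <= dist x v + dist u v.
  by rewrite (dist_sym u v); exact: dist_triangle.
have b6 : dist x v <= dist x u + dist u v by exact: dist_triangle.
case: (ltngtP (dist x u) (dist x v)) => xuv.
- case: (ltnP (dist x v) (dist x u + dist u v)) => h.
    by have := u2 h; have := v1 xuv; lia.
  lia.
- case: (ltnP (dist x u) (dist x v + dist u v)) => h.
    by have := v2 h; have := u1 xuv; lia.
  lia.
- have c1 : dist x u' <= dist x u.
    by apply: (@ball_between _ _ u v); lia.
  have c2 : dist x v' <= dist x u.
    by apply: (@ball_between _ _ u v); rewrite ?(dist_sym v' v); lia.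
  lia.
Qed.

End WeaklyBridged.

(** * Weak Cartesian products *)

Section WeakProduct.
Variables (I : Type) (H : I -> sgraph) (b : forall i, H i).
Hypothesis Hconn : forall i, connected (H i).
Notation P := (weak_cart_product b).
Implicit Types f g x u v : P.

Definition coord f i : H i := sval f i.

Lemma product_ext f g : (forall i, coord f i = coord g i) -> f = g.
Proof. by move=> fg; apply: val_inj; apply: functional_extensionality_dep. Qed.

Lemma product_adjP f g : adj f g <->
  exists i, adj (coord f i) (coord g i) /\
            forall j, j <> i -> coord f j = coord g j.
Proof. by split => /asboolP. Qed.

Definition update_fun f i (c : H i) : forall j, H j :=
  @dfwith {classic I} (fun j => H j) (sval f) i c.

Lemma update_subproof f i (c : H i) :
  update_fun f c \in [set g | finite_set [set j | g j <> b j]].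
Proof.
apply/mem_set => /=; have /set_mem /= ffin := svalP f.
apply: (@sub_finite_set _ _ ([set j | sval f j <> b j] `|` [set i])).
  move=> j /=; case: (pselect (j = i)) => [|ji]; first by right.
  by rewrite /update_fun dfwith_out; [left|apply/eqP => /esym].
by rewrite finite_setU; split=> //; apply: finite_set1.
Qed.

Definition update f i (c : H i) : P :=
  exist (fun g : forall j, H j => g \in [set g | finite_set [set j | g j <> b j]])
    (update_fun f c) (update_subproof f c).

Lemma update_in f i (c : H i) : coord (update f c) i = c.
Proof. exact: (@dfwith_in {classic I} (fun j => H j)). Qed.

Lemma update_out f i (c : H i) j : j <> i -> coord (update f c) j = coord f j.
Proof.
move=> ji; apply: (@dfwith_out {classic I} (fun j => H j)).
by apply/eqP => /esym.
Qed.

Lemma update_eq f g i (c : H i) :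
  coord g i = c -> (forall j, j <> i -> coord f j = coord g j) ->
  update f c = g.
Proof.
move=> gi fg; apply: product_ext => j; case: (pselect (j = i)) => [->|ji].
  by rewrite update_in.
by rewrite update_out ?fg.
Qed.

Lemma update_id f i : update f (coord f i) = f.
Proof. exact: update_eq. Qed.

Lemma update_update f i (c c' : H i) : update (update f c) c' = update f c'.
Proof.
apply: update_eq => [|j ji]; first by rewrite update_in.
by rewrite !update_out.
Qed.

Lemma update_path f i (c : H i) p :
  path adj c p -> path adj (update f c) (map (update f (i := i)) p).
Proof.
apply: homo_path => x y xy; apply/product_adjP; exists i.
by rewrite !update_in; split=> // j ji; rewrite !update_out.
Qed.

Lemma product_connected : connected P.
Proof.
move=> f g.
have [s sP] : exists s : seq {classic I},
    forall i, coord f i <> coord g i -> (i : {classic I}) \in s.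
  have /set_mem /= ffin := svalP f; have /set_mem /= gfin := svalP g.
  have : finite_set ([set j : {classic I} | sval f j <> b j] `|`
                     [set j | sval g j <> b j]) by rewrite finite_setU.
  case/finite_seqP => s sE; exists s => i fg.
  suff : [set` s] i by [].
  rewrite -sE /=; apply: contrapT => /not_orP[/contrapT fi /contrapT gi].
  by apply: fg; rewrite /coord fi gi.
elim: s f sP => [|i s IH] f fg.
  exists [::]; split=> //=; apply: product_ext => i.
  by apply: contrapT => /fg.
have [p [ip pi]] := Hconn (coord f i) (coord g i).
have [|q [fq qg]] := IH (update f (coord g i)).
  move=> j; case: (pselect (j = i)) => [->|ji]; first by rewrite update_in.
  by rewrite update_out // => /fg; rewrite inE => /orP[/eqP|].
exists (map (update f (i := i)) p ++ q).
rewrite cat_path last_cat -[f in path _ f](update_id f i) update_path //=.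
by rewrite -[f in last f](update_id f i) last_map pi.
Qed.

Lemma dist_update2 f i (c c' : H i) : dist (update f c) (update f c') <= dist c c'.
Proof.
have [p [cp <- <-]] := geodesic_exists (@Hconn i) c c'.
by rewrite -last_map -(size_map (update f (i := i))) dist_le_size ?update_path.
Qed.

(** For the lower bound, each step of a walk from f to g changes a single
coordinate, so it shortens only one of the two terms. *)
Lemma dist_split f g i :
  dist f g = dist (coord f i) (coord g i) + dist (update f (coord g i)) g.
Proof.
apply/eqP; rewrite eqn_leq; apply/andP; split.
  apply: leq_trans (dist_triangle product_connected (update f (coord g i)) _ _) _.
  by rewrite leq_add2r -{1}(update_id f i) dist_update2.
have [p [fp <- <-]] := geodesic_exists product_connected f g.
elim: p f fp => [|h p IH] f; first by rewrite update_id !distxx.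
case/andP => /product_adjP[j [fh fh']] /IH.
rewrite -[last f _]/(last h p) -[size (h :: p)]/(size p).+1.
set l := last h p => hl.
case: (pselect (j = i)) => [ji|ji].
  subst j; rewrite (_ : update f _ = update h (coord l i)).
    have := dist_adjl (@Hconn i) (coord l i) fh; lia.
  apply: update_eq => [|j ji]; first by rewrite update_in.
  by rewrite update_out // fh'.
rewrite fh'; last by apply/nesym.
suff : dist (update f (coord l i)) l <= (dist (update h (coord l i)) l).+1 by lia.
apply: dist_adjl; first exact: product_connected.
apply/product_adjP; exists j; rewrite !update_out //; split=> // k kj.
case: (pselect (k = i)) => [->|ki]; first by rewrite !update_in.
by rewrite !update_out // fh'.
Qed.

(** The frozen part of the distance does not depend on the common value at
which coordinate i is frozen; this is seen by computing d(x[i := c], f) in two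
ways. *)
Lemma dist_update x f i (c : H i) :
  dist x (update f c) = dist (coord x i) c + dist (update x (coord f i)) f.
Proof.
rewrite (dist_split _ _ i) update_in; congr addn.
have := dist_split (update x c) f i.
rewrite dist_sym (dist_split _ _ i) !update_in update_update.
by rewrite (dist_sym c) (dist_sym (update f c)) => /addnI.
Qed.

Lemma product_lozenge : (forall i, lozenge_property (H i)) -> lozenge_property P.
Proof.
move=> lozH u v s uv2.
have [i uvi] : exists i, coord u i <> coord v i.
  apply/existsNP => uv; move: uv2.
  by rewrite (product_ext uv) distxx.
have dx x (c : H i) := dist_update x u c.
have du (c c' : H i) : dist (update u c) (update u c') = dist c c'.
  by rewrite dist_update update_in update_update update_id distxx addn0.
have duu c : dist u (update u c) = dist (coord u i) c.
  by rewrite -{1}(update_id u i) du.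
case: (pselect (update u (coord v i) = v)) => [uv|uv].
  (* u and v differ only at i. *)
  move: uv2; rewrite -uv duu => uv2.
  have [c [c' [uc cv cs]]] := lozH i _ _ (map (coord^~ i) s) uv2.
  exists (update u c), (update u c'); rewrite du duu; split=> // x xs.
  rewrite -{3}(update_id u i) !dist_update.
  have := cs (coord x i) (map_f _ xs); lia.
(* u and v differ at i and elsewhere: exchange their values at i. *)
have := dist_gt0 product_connected uv.
have := dist_gt0 (@Hconn i) uvi.
have := dist_split u v i => dE d1 d2.
exists (update u (coord v i)), (update v (coord u i)).
rewrite duu; split; [lia|lia|] => x _.
rewrite !dist_update (dist_split x u i) (dist_split x v i); lia.
Qed.

End WeakProduct.

(** * Retracts *)

Lemma nonexpansive (G K : sgraph) (f : G -> K) :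
  connected G -> connected K ->
  (forall u v, adj u v -> dist (f u) (f v) <= 1) ->
  forall u v, dist (f u) (f v) <= dist u v.
Proof.
move=> Gc Kc f1 u v; have [p [up <- <-]] := geodesic_exists Gc u v.
elim: p u up => [|w p IH] u /=; first by rewrite distxx.
case/andP=> /f1 uw /IH wp; have := dist_triangle Kc (f w) (f u) (f (last w p)).
lia.
Qed.

(** A retract is thus an isometric subgraph: a shortest path of K between two
of its vertices is mapped by h to a walk that is no longer. *)
Lemma retract_maps (G K : sgraph) : connected G -> connected K ->
  retract_of G K ->
  exists (f : G -> K) (h : K -> G), [/\ cancel f h,
    forall u v, dist (f u) (f v) <= dist u v &
    forall x y, dist (h x) (h y) <= dist x y].
Proof.
move=> Gc Kc [phi [phiK phi1] [g [g' gK g'K] gadj]].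
have phi_in x : phi x \in range phi by apply/mem_set; exists x.
pose h x := g' (exist _ (phi x) (phi_in x)).
have ghE x : sval (g (h x)) = phi x by rewrite /h g'K.
exists (fun u => sval (g u)), h; split.
- move=> u; apply: (can_inj gK); apply: val_inj.
  by rewrite /= ghE; have /set_mem [x _ <-] := svalP (g u); rewrite phiK.
- apply: (nonexpansive Gc Kc) => u v.
  by rewrite -gadj => /(dist_adj Kc) ->.
- apply: (nonexpansive Kc Gc) => x y xy.
  have := phi1 x y; rewrite (dist_adj Kc xy) => /(dist_le1 Kc)[e|a].
    by rewrite (_ : h x = h y) ?distxx //; apply: (can_inj gK); apply: val_inj; rewrite /= !ghE.
  by rewrite (dist_adj Gc) // -gadj; rewrite /= /induced_adj !ghE.
Qed.

Lemma retract_lozenge (G K : sgraph) : connected G -> connected K ->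
  retract_of G K -> lozenge_property K -> lozenge_property G.
Proof.
move=> Gc Kc /(retract_maps Gc Kc)[f [h [fK f1 h1]]] loz u v s uv2.
have fE u1 v1 : dist (f u1) (f v1) = dist u1 v1.
  by apply/eqP; rewrite eqn_leq f1 /= -{1}(fK u1) -{1}(fK v1) h1.
have hl x w : dist x (h w) <= dist (f x) w by rewrite -{1}(fK x) h1.
have [|a [c [ua av ac]]] := loz (f u) (f v) (map f s); first by rewrite fE.
rewrite !fE in ua av; exists (h a), (h c); split.
- exact: leq_ltn_trans (hl _ _) ua.
- by rewrite dist_sym; apply: leq_ltn_trans (hl _ _) _; rewrite dist_sym.
- move=> x xs; rewrite -(fE x u) -(fE x v).
  exact: leq_trans (leq_add (hl _ _) (hl _ _)) (ac _ (map_f _ xs)).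
Qed.

(** * Medians *)

Lemma median_fun_finite (R : realType) (G : sgraph) (pi : G -> R) :
  profile pi -> exists s : seq G,
    forall x, median_fun pi x = (\sum_(u <- s) pi u * (dist u x)%:R)%R.
Proof.
case=> _ /finite_seqP[s sE]; exists (undup s) => x.
rewrite /median_fun (fsbigE (undup s)) ?undup_uniq //.
  by apply: eq_bigl => u; rewrite in_setT.
move=> u _; rewrite mem_undup => us.
suff -> : pi u = 0%R by rewrite mul0r.
apply/eqP/negPn/negP => piu.
have : [set u | pi u != 0%R] u by [].
by rewrite sE /= (negPf us).
Qed.

Lemma lozenge_median (R : realType) (G : sgraph) (pi : G -> R) (u v : G) :
  lozenge_property G -> profile pi -> Med pi u -> Med pi v -> 2 < dist u v ->
  exists w, [/\ Med pi w, dist u w < dist u v & dist w v < dist u v].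
Proof.
move=> loz pip uM vM uv2; have [s sE] := median_fun_finite pip.
have [u' [v' [uu' u'v h]]] := loz u v s uv2.
exists u'; split=> // y.
have : (median_fun pi u' + median_fun pi v' <= median_fun pi u + median_fun pi v)%R.
  rewrite !sE -!big_split /= [leLHS]big_seq [leRHS]big_seq.
  apply: ler_sum => x xs; rewrite -!mulrDr -!natrD.
  by apply: ler_wpM2l; [case: pip | rewrite ler_nat h].
have := uM y; have := vM v'; lra.
Qed.

Theorem proposition58 (R : realType) (G : sgraph)
    (Gconn : connected G) (Gfin : locally_finite G) (Gbuc : bucolic G)
    (pi : G -> R) (pi_profile : profile pi) :
  connected (@induced (square G) (Med pi)).
Proof.
have loz : lozenge_property G.
  have [I [H [b [Hwb Gret]]]] := Gbuc.
  have Hconn i : connected (H i) by case: (Hwb i).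
  apply: (retract_lozenge Gconn _ Gret); first exact: product_connected.
  by apply: product_lozenge => // i; apply: weakly_bridged_lozenge.
move=> u v.
elim/ltn_ind: {u v}(@dist G (sval u) (sval v)) {-2}u {-2}v
  (erefl (@dist G (sval u) (sval v))) => n IH u v uvn.
case: (ltnP 2 n) => [n2|n2].
  have /set_mem uM := svalP u; have /set_mem vM := svalP v.
  have [|w [wM uw wv]] := lozenge_median loz pi_profile uM vM; first by rewrite uvn.
  rewrite uvn in uw wv.
  pose w' : induced (Med pi) := exist _ w (mem_set wM).
  have [p [up pw]] := IH _ uw u w' erefl.
  have [q [wq qv]] := IH _ wv w' v erefl.
  by exists (p ++ q); rewrite cat_path last_cat up pw.
case: (eqVneq u v) => [<-|uv]; first by exists [::].
exists [:: v]; split=> //; rewrite [path _ _ _]andbT.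
apply/andP; split; last by rewrite uvn.
by apply: contra uv => /eqP/val_inj ->.
Qed.
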